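(* Fix a field $\mathbb{F}$. There is a family of unsatisfiable $3$-CNF formulas $\phi_0(\bar x,\bar z)\wedge\phi_1(\bar y,\bar z)$, where $\bar x,\bar y,\bar z$ are pairwise disjoint tuples of variables, such that every $\mathrm{roABP}$-$\mathrm{IPS}_{\mathrm{LIN}}$ refutation over $\mathbb{F}$ of $\phi_0\wedge\phi_1$ in any variable ordering in which all $\bar x$ variables precede all other variables has width at least $2^{N^{\Omega(1)}}$, where $N$ is the number of variables of the formula.
   Context: An roABP in the variable ordering $x_1<\cdots<x_n$ is a sequence of matrices $M_1,\ldots,M_n$ whose entries in $M_i$ are univariate polynomials in $x_i$; it computes the $(1,1)$ entry of $M_1\cdots M_n$; its width is the maximal dimension of the matrices. The standard translation of a clause $C=\bigvee_{i\in I}x_i\vee\bigvee_{j\in J}\neg x_j$ is $\prod_{i\in I}(1-x_i)\prod_{j\in J}x_j$, and of a CNF it is the set of translations of its clauses together with $x^2-x$ for every variable $x$. An $\mathrm{roABP}$-$\mathrm{IPS}_{\mathrm{LIN}}$ refutation of a CNF in a given variable ordering is a family $(g_q)$, indexed by the polynomials $q$ of its standard translation, with $\sum_q g_q q=1$ as formal polynomials, each $g_q$ computed by an roABP in that ordering; its width is the maximal width of these roABPs. *)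

(* Defs.v *)
From Stdlib Require Export Reals.
From HB Require Import structures.
From mathcomp Require Export all_boot all_order all_fingroup all_algebra.
From mathcomp Require Export mpoly.

Set Implicit Arguments.
Unset Strict Implicit.
Unset Printing Implicit Defensive.

Import GRing.Theory.
Local Open Scope ring_scope.

(* mathcomp takes the key %R for ring_scope. *)
Delimit Scope R_scope with coqR.

(* The variables of a formula in N variables are the elements of 'I_N. The     *)
(* literal (i, true) is x_i and (i, false) is its negation.                    *)
Definition literal (N : nat) := ('I_N * bool)%type.
Definition clause (N : nat) := {set literal N}.
Definition cnf (N : nat) := {set clause N}.

Section CNF.

Variable N : nat.
Implicit Types (C : clause N) (phi : cnf N) (a : 'I_N -> bool).

Definition sat_clause a C := [exists l in C, a l.1 == l.2].

Definition sat_cnf a phi := [forall C in phi, sat_clause a C].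

Definition unsatisfiable phi := forall a, ~~ sat_cnf a phi.

Definition is_kcnf (k : nat) phi := forall C, C \in phi -> (#|C| <= k)%N.

Definition cnf_vars phi : {set 'I_N} :=
  \bigcup_(C in phi) [set l.1 | l in C].

End CNF.

Record split_cnf := SplitCNF {
  nvars : nat;
  xvars : {set 'I_nvars};
  yvars : {set 'I_nvars};
  zvars : {set 'I_nvars};
  phi0 : cnf nvars;
  phi1 : cnf nvars;
  disjoint_xy : [disjoint xvars & yvars];
  disjoint_xz : [disjoint xvars & zvars];
  disjoint_yz : [disjoint yvars & zvars];
  cover_vars : xvars :|: yvars :|: zvars = [set: 'I_nvars];
  phi0_vars : cnf_vars phi0 \subset xvars :|: zvars;
  phi1_vars : cnf_vars phi1 \subset yvars :|: zvars
}.

Definition formula (phi : split_cnf) : cnf (nvars phi) := phi0 phi :|: phi1 phi.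

Section RoABP.

Variables (F : fieldType) (N : nat).

Definition clause_poly (C : clause N) : {mpoly F[N]} :=
  (\prod_(i | (i, true) \in C) (1 - 'X_i)) *
  (\prod_(j | (j, false) \in C) 'X_j).

(* Duplicates are removed because a refutation is indexed by the polynomials   *)
(* of the translation: in characteristic 2 the tautological clause on x and    *)
(* not x has the translation x^2 - x.                                          *)
Definition standard_translation (phi : cnf N) : seq {mpoly F[N]} :=
  undup ([seq clause_poly C | C in phi] ++ [seq 'X_i ^+ 2 - 'X_i | i : 'I_N]).

Definition univariate_in (x : 'I_N) (p : {mpoly F[N]}) : Prop :=
  exists q : {poly F}, p = horner_alg 'X_x q.

(* A variable ordering is a permutation s, where s k is the variable in        *)
(* position k (counted from 0). Dimensions are stored minus one, so that there *)
(* is always a top left entry. Only the matrices 0, ..., N - 1 matter.         *)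
Record roABP (s : 'S_N) := RoABP {
  rdim : nat -> nat;
  rmat : forall k : nat, 'M[{mpoly F[N]}]_((rdim k).+1, (rdim k.+1).+1);
  rmat_univariate : forall (k : 'I_N) a b, univariate_in (s k) (rmat k a b)
}.

Variable s : 'S_N.

Fixpoint roABP_prod (A : roABP s) (k : nat) :
    'M[{mpoly F[N]}]_((rdim A 0).+1, (rdim A k).+1) :=
  match k with
  | 0 => 1%:M
  | k'.+1 => roABP_prod A k' *m rmat A k'
  end.

Definition roABP_poly (A : roABP s) : {mpoly F[N]} :=
  roABP_prod A N ord0 ord0.

Definition roABP_width (A : roABP s) : nat := \max_(k < N.+1) (rdim A k).+1.

(* The family g_q is given by the roABPs that compute its members; values of G *)
(* outside the standard translation are irrelevant.                            *)
Definition is_refutation (phi : cnf N) (G : {mpoly F[N]} -> roABP s) : Prop :=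
  \sum_(q <- standard_translation phi) roABP_poly (G q) * q = 1.

Definition refutation_width (phi : cnf N) (G : {mpoly F[N]} -> roABP s) : nat :=
  \max_(q <- standard_translation phi) roABP_width (G q).

End RoABP.

Definition x_first (phi : split_cnf) (s : 'S_(nvars phi)) : Prop :=
  forall i j, s i \in xvars phi -> s j \notin xvars phi -> (i < j)%N.

(* Main.v *)
Require Import Defs.
From Stdlib Require Import Lra.
From mathcomp Require Import zify.

Set Implicit Arguments.
Unset Strict Implicit.
Unset Printing Implicit Defensive.

Import GRing.Theory.
Local Open Scope ring_scope.

(* Split the variables into the x-variables and the rest. Evaluated on Boolean
   inputs, an roABP of width w that reads the x-variables first is a matrix of
   rank at most w, and a clause translates into the indicator of a combinatorial
   rectangle. A refutation therefore writes any matrix M as a sum, over the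
   clauses, of M restricted to the falsifying rectangle times a matrix of rank at
   most w: if M has high rank but low rank on each of these rectangles, then w is
   large (the rank measure of monotone span programs).

   The formula is a pebbling contradiction on the (h+1) x (h+1) grid, in which the
   node i is pebbled when two symbols x_i and z_i differ. Call a set T of nodes
   unblocked when some path from a source to the apex avoids it, and let M(x, z) be
   the sum, over the unblocked T, of the products of -[x_i = z_i] for i not in T.
   Adding to T a node whose two predecessors are in T does not change whether T is
   unblocked, so M vanishes wherever a pebbling rule at an inner node fails, and it
   vanishes where the apex is pebbled. Adding a source to T does not change it
   either as long as |T| < h, so where a source is not pebbled only the T with at
   least h nodes contribute, and M has rank at most 2^(1-h) r^n there, for n nodes
   and r = 4n symbols. Since the empty set is unblocked, M itself has rank at least
   r^n. *)

(** * Rank of functions of two arguments *)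

Section RankBound.

Variables (F : fieldType) (X Y : Type).
Implicit Types f g : X -> Y -> F.

Definition rank_le (d : nat) f : Prop :=
  exists (u : X -> 'I_d -> F) (v : 'I_d -> Y -> F),
    forall x y, f x y = \sum_i u x i * v i y.

Lemma rank_le_ext d f g : (forall x y, f x y = g x y) -> rank_le d g -> rank_le d f.
Proof. by move=> fg [u [v guv]]; exists u, v => x y; rewrite fg. Qed.

Lemma rank_le_fin (K : finType) (u : X -> K -> F) (v : K -> Y -> F) f :
  (forall x y, f x y = \sum_k u x k * v k y) -> rank_le #|K| f.
Proof.
move=> fuv; exists (fun x i => u x (enum_val i)), (fun i y => v (enum_val i) y).
move=> x y; rewrite fuv (reindex _ (onW_bij _ (@enum_val_bij K))).
by apply: eq_big => // k; rewrite inE.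
Qed.

Lemma rank_leD d e f g :
  rank_le d f -> rank_le e g -> rank_le (d + e) (fun x y => f x y + g x y).
Proof.
case=> [u [v fuv]] [u' [v' guv]].
rewrite -[d]card_ord -[e]card_ord -card_sum.
apply: (@rank_le_fin _ (fun x k => match k with inl i => u x i | inr i => u' x i end)
  (fun k y => match k with inl i => v i y | inr i => v' i y end)) => x y.
by rewrite fuv guv big_sumType.
Qed.

(** The entrywise product is factored by the tensor product of the two factorisations. *)
Lemma rank_leM d e f g :
  rank_le d f -> rank_le e g -> rank_le (d * e) (fun x y => f x y * g x y).
Proof.
case=> [u [v fuv]] [u' [v' guv]].
rewrite -[d]card_ord -[e]card_ord -card_prod.
apply: (@rank_le_fin _ (fun x k => u x k.1 * u' x k.2)
  (fun k y => v k.1 y * v' k.2 y)) => x y.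
rewrite fuv guv big_distrlr pair_big /=.
by apply: eq_bigr => -[i j] _ /=; rewrite mulrACA.
Qed.

Lemma rank_le0 d : rank_le d (fun _ _ => 0).
Proof.
by exists (fun _ _ => 0), (fun _ _ => 0) => x y; rewrite big1 // => i _; rewrite mul0r.
Qed.

Lemma rank_le_leq d e f : (d <= e)%N -> rank_le d f -> rank_le e f.
Proof.
move=> le_de fd; rewrite -(subnKC le_de).
by apply: rank_le_ext (rank_leD fd (rank_le0 _)) => x y; rewrite addr0.
Qed.

Lemma rank_le_sum (I : Type) (r : seq I) (P : pred I) (d : I -> nat)
    (f : I -> X -> Y -> F) :
  (forall i, P i -> rank_le (d i) (f i)) ->
  rank_le (\sum_(i <- r | P i) d i)%N (fun x y => \sum_(i <- r | P i) f i x y).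
Proof.
move=> rf; elim: r => [|i r IHr].
  by rewrite big_nil; apply: rank_le_ext (rank_le0 _) => x y; rewrite big_nil.
rewrite big_cons; case: ifP => Pi.
  by apply: rank_le_ext (rank_leD (rf _ Pi) IHr) => x y; rewrite big_cons Pi.
by apply: rank_le_ext IHr => x y; rewrite big_cons Pi.
Qed.

Lemma rank_le_rank1 (u : X -> F) (v : Y -> F) : rank_le 1 (fun x y => u x * v y).
Proof.
by exists (fun x _ => u x), (fun _ y => v y) => x y; rewrite big_ord1.
Qed.

Lemma rank_le_prod (I : Type) (r : seq I) (P : pred I) (d : I -> nat)
    (f : I -> X -> Y -> F) :
  (forall i, P i -> rank_le (d i) (f i)) ->
  rank_le (\prod_(i <- r | P i) d i)%N (fun x y => \prod_(i <- r | P i) f i x y).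
Proof.
move=> rf; elim: r => [|i r IHr].
  rewrite big_nil; apply: rank_le_ext (rank_le_rank1 (fun=> 1) (fun=> 1)) => x y.
  by rewrite big_nil mulr1.
rewrite big_cons; case: ifP => Pi.
  by apply: rank_le_ext (rank_leM (rf _ Pi) IHr) => x y; rewrite big_cons Pi.
by apply: rank_le_ext IHr => x y; rewrite big_cons Pi.
Qed.

End RankBound.

Lemma rank_le_lincomb (F : fieldType) (X : finType) (X' Y : Type) d
    (f : X -> Y -> F) (c : X' -> X -> F) :
  rank_le d f -> rank_le d (fun x' y => \sum_x c x' x * f x y).
Proof.
case=> u [v fuv]; exists (fun x' i => \sum_x c x' x * u x i), v => x' y.
under eq_bigr do rewrite fuv big_distrr /=.
rewrite exchange_big; apply: eq_bigr => i _.
by rewrite big_distrl; apply: eq_bigr => x _; rewrite mulrA.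
Qed.

Lemma rank_le_delta (F : fieldType) (X : finType) d (c : F) :
  c != 0 -> rank_le d (fun x y : X => c * (x == y)%:R) -> (#|X| <= d)%N.
Proof.
move=> c0 [u [v cuv]].
pose A : 'M[F]_(#|X|, d) := \matrix_(i, j) u (enum_val i) j.
pose B : 'M[F]_(d, #|X|) := \matrix_(i, j) v i (enum_val j).
have AB : A *m B = c%:M.
  apply/matrixP => i j; rewrite !mxE -(mulr_natr c).
  under eq_bigr do rewrite !mxE.
  by rewrite -cuv (inj_eq enum_val_inj).
rewrite -[leqLHS](@mxrank1 F) -(mxrank_scale_nz _ c0) scalemx1 -AB.
exact: leq_trans (mxrankM_maxl A B) (rank_leq_col A).
Qed.

(** * Cutting an roABP between two positions *)

Section RoABPCut.

Variables (F : fieldType) (N : nat) (s : 'S_N) (A : roABP F s).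
Implicit Types v w : 'I_N -> F.

Lemma univariate_meval (x : 'I_N) (p : {mpoly F[N]}) v w :
  univariate_in x p -> v x = w x -> p.@[v] = p.@[w].
Proof.
case=> q -> vw; elim/poly_ind: q => [|q c IHq]; first by rewrite !rmorph0.
by rewrite !rmorphD !rmorphM /= horner_algX horner_algC !mevalZ !mevalXU !meval1 IHq vw.
Qed.

Let matv v (k : nat) := map_mx (meval v) (rmat A k).
Let prodv v k := map_mx (meval v) (roABP_prod A k).

Let matv_local v w (k : 'I_N) : v (s k) = w (s k) -> matv v k = matv w k.
Proof.
move=> vw; apply/matrixP => a b; rewrite !mxE.
exact: univariate_meval (rmat_univariate a b) vw.
Qed.

Let prodv_prefix v w k : (k <= N)%N ->
  (forall i : 'I_N, (i < k)%N -> v (s i) = w (s i)) -> prodv v k = prodv w k.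
Proof.
rewrite /prodv; elim: k => [|k IHk] ltkN vw; first by rewrite !map_mx1.
rewrite /= !map_mxM IHk ?(ltnW ltkN) //; last by move=> i ltik; apply: vw (ltnW _).
by congr (_ *m _); apply: (@matv_local v w (Ordinal ltkN)); apply: vw => /=.
Qed.

(** [Q] is the product of the matrices at positions [k] to [m - 1]. *)
Let prodv_suffix k m : (k <= m <= N)%N ->
  exists Q : ('I_N -> F) -> 'M[F]_((rdim A k).+1, (rdim A m).+1),
    (forall v, prodv v m = prodv v k *m Q v) /\
    (forall v w, (forall i : 'I_N, (k <= i)%N -> v (s i) = w (s i)) -> Q v = Q w).
Proof.
case/andP=> lekm lemN; elim: m lekm lemN => [|m IHm] lekm ltmN.
  move: lekm; rewrite leqn0 => /eqP->.
  by exists (fun=> 1%:M); split=> // v; rewrite mulmx1.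
move: lekm; rewrite leq_eqVlt => /predU1P[->|lekm].
  by exists (fun=> 1%:M); split=> // v; rewrite mulmx1.
have [Q [prodQ Qloc]] := IHm lekm (ltnW ltmN).
exists (fun v => Q v *m matv v m); split=> [v|v w vw].
  by rewrite mulmxA -prodQ /prodv /= map_mxM.
by rewrite (Qloc v w vw) (@matv_local v w (Ordinal ltmN)) // vw.
Qed.

(** The computed entry is the first row of the product before the cut times the first column of the
    product after it. *)
Lemma roABP_poly_cut (k : nat) : (k <= N)%N ->
  exists (a b : ('I_N -> F) -> 'I_(roABP_width A) -> F),
  [/\ forall v, (roABP_poly A).@[v] = \sum_i a v i * b v i,
      forall v w, (forall i : 'I_N, (i < k)%N -> v (s i) = w (s i)) -> a v =1 a w
    & forall v w, (forall i : 'I_N, (k <= i)%N -> v (s i) = w (s i)) -> b v =1 b w].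
Proof.
move=> lekN; have [|Q [prodQ Qloc]] := @prodv_suffix k N; first by rewrite lekN leqnn.
have le_width : ((rdim A k).+1 <= roABP_width A)%N.
  exact: (@leq_bigmax_cond _ predT (fun k : 'I_N.+1 => (rdim A k).+1)
    (Ordinal (lekN : (k < N.+1)%N))).
(* Zeros pad the dimension at the cut up to the width. *)
pose ext (c : 'I_(rdim A k).+1 -> F) (i : 'I_(roABP_width A)) : F :=
  if insub (val i) is Some j then c j else 0.
exists (fun v => ext (prodv v k ord0)), (fun v => ext (fun j => Q v j ord0)).
split=> [v|v w vw i|v w vw i]; last 2 first.
- by rewrite /ext; case: insubP => // j _ _; rewrite (prodv_prefix lekN vw).
- by rewrite /ext; case: insubP => // j _ _; rewrite (Qloc v w vw).
transitivity (prodv v N ord0 ord0); first by rewrite mxE.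
pose c (i : nat) : F :=
  if insub i is Some j then prodv v k ord0 j * Q v j ord0 else 0.
rewrite prodQ mxE (eq_bigr (fun i : 'I__ => c i)) => [|i _]; last by rewrite /c valK.
rewrite (big_ord_widen _ c le_width) big_mkcond; apply: eq_bigr => i _.
rewrite /c /ext; case: insubP => [j ltj _|/negPf ltjF]; rewrite ?ltj ?ltjF ?mul0r //.
Qed.

End RoABPCut.

(** * Unblocked sets in the pebbling grid *)

Section Grid.

Variable h : nat.

Definition node : finType := ('I_h.+1 * 'I_h.+1)%type.

Implicit Types (T : {set node}) (v : node).

Definition apex : node := (ord0, ord0).

Definition source (v : node) := (v.1 == ord_max) || (v.2 == ord_max).

(** On the far border [inord] falls back to a default; the pebbling rules use predecessors of inner
    nodes only. *)
Definition row_pred (v : node) : node := (inord v.1.+1, v.2).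
Definition col_pred (v : node) : node := (v.1, inord v.2.+1).

(* Equivalently, some path from a source to the apex avoids T. *)
Definition unblocked (T : {set node}) :=
  [exists U : {set node}, [&& apex \in U, [disjoint U & T] &
    [forall v in U, [|| source v, row_pred v \in U | col_pred v \in U]]]].

Lemma unblockedP (T : {set node}) :
  reflect (exists U : {set node}, [/\ apex \in U, forall v, v \in U -> v \notin T &
    forall v, v \in U -> ~~ source v -> (row_pred v \in U) || (col_pred v \in U)])
  (unblocked T).
Proof.
apply: (iffP existsP) => -[U].
  case/and3P=> apU dUT /forall_inP predU; exists U; split=> // v vU.
    by rewrite (disjointFr dUT vU).
  by move/negPf=> nsrc; have := predU v vU; rewrite nsrc.
case=> apU dUT predU; exists U; rewrite apU /=; apply/andP; split.
  by rewrite disjoint_subset; apply/subsetP => v /dUT; rewrite inE.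
apply/forall_inP => v vU; case: (boolP (source v)) => //= nsrc.
exact: predU.
Qed.

Lemma unblockedS T T' : T \subset T' -> unblocked T' -> unblocked T.
Proof.
move=> /subsetP sTT' /unblockedP[U [apU dUT predU]].
by apply/unblockedP; exists U; split=> // v /dUT; apply/contra/sTT'.
Qed.

Lemma unblocked0 : unblocked set0.
Proof.
by apply/unblockedP; exists setT; split=> [|v|v] *; rewrite !inE.
Qed.

Lemma apex_unblocked T : unblocked T -> apex \notin T.
Proof. by case/unblockedP=> U [apU dUT _]; apply: dUT. Qed.

(** A witness containing [v] would contain a predecessor of [v], but both lie in [T]. So every
    witness for [T] already avoids [v]. *)
Lemma unblocked_pred T v : ~~ source v -> row_pred v \in T -> col_pred v \in T ->
  unblocked (v |: T) = unblocked T.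
Proof.
move=> nsrc p1T p2T; apply/idP/idP; first exact: unblockedS (subsetUr _ _).
case/unblockedP=> U [apU dUT predU]; apply/unblockedP; exists U; split=> // w wU.
rewrite in_setU1 negb_or dUT // andbT; apply: contraTneq wU => ->.
apply/negP => vU; have := predU v vU nsrc.
by case/orP=> /dUT; rewrite ?p1T ?p2T.
Qed.

(* Some line [c = i] with [i < h] is free of [T]; paths are rerouted along it to
   its far end, which keeps them away from the sources on [c = h]. *)
Lemma unblocked_reroute (c : node -> 'I_h.+1) T s :
  c apex = ord0 ->
  (forall v, ~~ source v -> (c (row_pred v) <= (c v).+1)%N /\ (c (col_pred v) <= (c v).+1)%N) ->
  (forall v, c (row_pred v) = c v \/ c (col_pred v) = c v) ->
  c s = ord_max -> (#|T| < h)%N -> unblocked T -> unblocked (s |: T).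
Proof.
move=> c0 cpred cline cs ltTh /unblockedP[U [apU dUT predU]].
(* Pigeonhole: there are [h] lines other than the last, and [T] has fewer nodes. *)
have [i imax iT] : exists2 i : 'I_h.+1, i != ord_max & i \notin [set c v | v in T].
  have /subsetPn[i] : ~~ ([set~ ord_max] \subset [set c v | v in T]).
    apply: contraL ltTh => /subset_leq_card; rewrite -leqNgt cardsC1 card_ord /=.
    by move/leq_trans; apply; apply: leq_imset_card.
  by rewrite !inE => imax iT; exists i.
apply/unblockedP; exists [set v | (v \in U) && (c v < i)%N || (c v == i)].
split=> [|v|v].
- rewrite inE apU c0 /= -val_eqE /=; case: (posnP i) => [->|//]; rewrite eqxx.
  by rewrite orbT.
- rewrite !inE negb_or => vU'; apply/andP; split.
    apply: contraTneq vU' => ->; rewrite cs negb_or negb_and -leqNgt leq_ord.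
    by rewrite orbT eq_sym.
  case/orP: vU' => [/andP[/dUT]//|/eqP cvi].
  by apply: contra iT => vT; rewrite -cvi; apply: imset_f.
- rewrite !inE => vU' nsrc; case/orP: vU' => [/andP[vU ltvi]|/eqP cvi]; last first.
    by case: (cline v) => ->; rewrite cvi eqxx !orbT.
  have [c1 c2] := cpred v nsrc.
  have step w : (c w <= (c v).+1)%N -> (c w < i)%N || (c w == i).
    by move=> lew; rewrite -val_eqE /= orbC -leq_eqVlt (leq_trans lew).
  by case/orP: (predU v vU nsrc) => ->; rewrite /= step ?orbT.
Qed.

Lemma unblocked_source T s :
  source s -> (#|T| < h)%N -> unblocked T -> unblocked (s |: T).
Proof.
have inc (i : 'I_h.+1) : i != ord_max -> (inord i.+1 : 'I_h.+1) = i.+1 :> nat.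
  by move=> imax; rewrite inordK // ltnS ltn_neqAle leq_ord andbT.
case/orP=> /eqP.
  apply: (@unblocked_reroute fst) => // [v|v]; last by right.
  by rewrite negb_or => /andP[n1 _] /=; rewrite inc.
apply: (@unblocked_reroute snd) => // [v|v]; last by left.
by rewrite negb_or => /andP[_ n2] /=; rewrite inc.
Qed.

(** Induction on the sum of the distances to the two far borders, which drops at each
    predecessor. *)
Lemma apex_ind (P : node -> Prop) :
  (forall v, source v -> P v) ->
  (forall v, ~~ source v -> P (row_pred v) -> P (col_pred v) -> P v) -> P apex.
Proof.
move=> Psrc Ppred.
suff H n v : (h - v.1 + (h - v.2) <= n)%N -> P v by apply: (H _ _ (leqnn _)).
elim: n v => [|n IHn] v le_n; case: (boolP (source v)) => [/Psrc//|nsrc].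
all: have /andP[n1 n2] : (v.1 < h)%N && (v.2 < h)%N
  by move: nsrc; rewrite negb_or -!val_eqE /= !ltn_neqAle !leq_ord !andbT.
  by move: le_n; rewrite leqn0 addn_eq0 !subn_eq0 leqNgt n1.
apply: Ppred => //; apply: IHn; rewrite /= inordK // -ltnS (leq_trans _ le_n) //.
  by rewrite ltn_add2r ltn_sub2l.
by rewrite ltn_add2l ltn_sub2l.
Qed.

End Grid.

Lemma sum_toggle (V : zmodType) (I : finType) (v : I) (f : {set I} -> V) :
  \sum_T f T = \sum_(T : {set I} | v \notin T) (f T + f (v |: T)).
Proof.
rewrite (bigID (fun T : {set I} => v \notin T)) /= big_split; congr (_ + _).
rewrite (reindex_onto (fun T => v |: T) (fun T => T :\ v)) /=; last first.
  by move=> T; rewrite negbK => vT; rewrite setD1K.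
apply: eq_bigl => T; rewrite in_setU1 eqxx /=.
apply/eqP/idP => [<-|vT]; first by rewrite !inE eqxx.
by rewrite setU1K.
Qed.

Lemma prod_if_set (I : finType) (S : {set I}) (a b : nat) :
  (\prod_i (if i \in S then a else b) = a ^ #|S| * b ^ (#|I| - #|S|))%N.
Proof.
rewrite (bigID (fun i => i \in S)) /=; congr (_ * _)%N.
  by rewrite (eq_bigr (fun=> a)) ?prod_nat_const // => i ->.
rewrite (eq_bigr (fun=> b)) => [|i /negPf->//].
rewrite (eq_bigl (mem (~: S))) => [|i]; last by rewrite !inE.
by rewrite prod_nat_const cardsCs setCK.
Qed.

(** * The pebbling matrix and its rank *)

Section PebblingMatrix.

Variables (F : fieldType) (h r : nat).

Definition xinput : finType := {ffun node h -> 'I_r.+1}.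
Definition zinput : finType := {ffun node h -> 'I_r}.

(* The symbols of [z] are shifted by one: [0] never agrees, so subtracting the
   row at [0] in [pebmat_rank] kills every term in which a factor is missing. *)
Definition agree (x : xinput) (z : zinput) (i : node h) := x i == lift ord0 (z i).

Definition pebmat (x : xinput) (z : zinput) : F :=
  \sum_(T : {set node h})
    (unblocked T)%:R * \prod_i (if i \in T then 1 else - (agree x z i)%:R).

(** Where [v] agrees, its factor is -1 for [T] and 1 for [v |: T], so the two products are
    opposite. *)
Lemma pebmat_toggle x z v : agree x z v ->
  pebmat x z = \sum_(T : {set node h} | v \notin T)
    ((unblocked (v |: T))%:R - (unblocked T)%:R) *
      \prod_i (if i \in v |: T then 1 else - (agree x z i)%:R).
Proof.
move=> xzv; rewrite /pebmat (sum_toggle v); apply: eq_bigr => T vT.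
rewrite mulrBl addrC; congr (_ + _); rewrite -mulrN; congr (_ * _).
rewrite (bigD1 v) //= [in RHS](bigD1 v) //= (negPf vT) setU11 xzv mulN1r mul1r.
by congr (- _); apply: eq_bigr => i /negPf iv; rewrite in_setU1 iv.
Qed.

Lemma pebmat_apex x z : ~~ agree x z (apex h) -> pebmat x z = 0.
Proof.
move=> nag; apply: big1 => T _.
case: (boolP (unblocked T)) => [/apex_unblocked apT|_]; last by rewrite mul0r.
by rewrite (bigD1 (apex h)) //= (negPf apT) (negPf nag) oppr0 mul0r mulr0.
Qed.

(** A set that misses a predecessor has a zero factor there; for a set with both, toggling [v]
    changes nothing. *)
Lemma pebmat_pred x z v : ~~ source v -> ~~ agree x z (row_pred v) ->
  ~~ agree x z (col_pred v) -> agree x z v -> pebmat x z = 0.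
Proof.
move=> nsrc n1 n2 xzv; rewrite (pebmat_toggle xzv); apply: big1 => T vT.
have zero w : w \notin T -> ~~ agree x z w ->
    \prod_i (if i \in v |: T then 1 else - (agree x z i)%:R) = 0 :> F.
  move=> wT nw; rewrite (bigD1 w) //= in_setU1 (negPf wT) orbF.
  rewrite (negPf nw) oppr0; case: eqP nw => [->|]; rewrite ?xzv //.
  by rewrite mul0r.
have [p1T|/zero->//] := boolP (row_pred v \in T); last by rewrite mulr0.
have [p2T|/zero->//] := boolP (col_pred v \in T); last by rewrite mulr0.
by rewrite unblocked_pred // subrr mul0r.
Qed.

(** Each node outside [T] contributes a factor of rank at most [r]; only sets too large for
    [unblocked_source] are counted. *)
Definition source_rank := (\sum_(T : {set node h} | h <= #|T|) r ^ (#|node h| - #|T|))%N.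

Lemma rank_le_agree i : rank_le r (fun x z => - (agree x z i)%:R : F).
Proof.
suff: rank_le #|'I_r| (fun (x : xinput) (z : zinput) => - (agree x z i)%:R : F).
  by rewrite card_ord.
apply: (rank_le_fin (u := fun (x : xinput) a => - (x i == lift ord0 a)%:R)
  (v := fun a (z : zinput) => (z i == a)%:R)) => x z.
rewrite (bigD1 (z i)) //= eqxx mulr1 big1 ?addr0 // => a /negPf.
by rewrite eq_sym => ->; rewrite mulr0.
Qed.

(** [B] keeps the toggled terms with at least [h] nodes in [T], and is defined on all inputs. The
    smaller sets cancel where [s] agrees. *)
Lemma pebmat_source s : (0 < r)%N -> source s ->
  exists2 B : xinput -> zinput -> F, rank_le source_rank B &
    forall x z, agree x z s -> pebmat x z = B x z.
Proof.
move=> r0 src; exists (fun x z => \sum_(T : {set node h} | (h <= #|T|)%N)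
  (s \notin T)%:R * ((unblocked (s |: T))%:R - (unblocked T)%:R) *
      \prod_i (if i \in s |: T then 1 else - (agree x z i)%:R)).
  apply: rank_le_sum => T leT.
  set c : F := _ * _.
  have prk : rank_le (\prod_(i : node h) (if i \in s |: T then 1 else r))%N
      (fun x z => \prod_i (if i \in s |: T then 1 else - (agree x z i)%:R : F)).
    apply: rank_le_prod => i _; case: ifP => _; last exact: rank_le_agree.
    by apply: rank_le_ext (rank_le_rank1 (fun=> 1) (fun=> 1)) => x z; rewrite mulr1.
  have := rank_leM (rank_le_rank1 (fun=> c) (fun=> 1)) prk.
  rewrite mul1n prod_if_set exp1n mul1n => crk.
  apply: rank_le_ext (rank_le_leq _ crk) => [x z|]; first by rewrite mulr1.
  by rewrite leq_pexp2l // leq_sub2l // subset_leq_card // subsetUr.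
move=> x z xzs; rewrite (pebmat_toggle xzs) big_mkcond [in RHS]big_mkcond /=.
apply: eq_bigr => T _; case: (boolP (s \in T)) => sT; rewrite /= ?mul0r ?if_same //.
rewrite mul1r; case: leqP => // ltTh.
case: (boolP (unblocked T)) => [ub|nub]; first by rewrite unblocked_source // subrr mul0r.
have /negPf-> : ~~ unblocked (s |: T) by apply: contra nub; apply: unblockedS (subsetUr _ _).
by rewrite subrr mul0r.
Qed.

(** The row operations [c] leave only the term of the empty set, which becomes a signed identity
    matrix on [zinput]. *)
Lemma pebmat_rank d : rank_le d pebmat -> (r ^ #|node h| <= d)%N.
Proof.
pose c (u : zinput) (x : xinput) : F :=
  \prod_i ((x i == lift ord0 (u i))%:R - (x i == ord0)%:R).
move/(rank_le_lincomb c) => rk.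
rewrite -[r in leqLHS]card_ord -card_ffun.
apply: (@rank_le_delta F _ _ ((-1) ^+ #|node h|)); first by rewrite signr_eq0.
apply: rank_le_ext rk => u z; rewrite /pebmat.
under eq_bigr => x _ do rewrite big_distrr /=.
rewrite exchange_big (bigD1 set0) //= [X in _ + X]big1 ?addr0 => [|T T0].
  under eq_bigr => x _ do rewrite unblocked0 mul1r -big_split /=.
  rewrite -(bigA_distr_bigA (fun i a =>
    ((a == lift ord0 (u i))%:R - (a == ord0)%:R) *
    (if i \in set0 then 1 else - (a == lift ord0 (z i))%:R))).
  rewrite (eq_bigr (fun i => - (u i == z i)%:R)) => [|i _].
    rewrite prodrN; congr (_ * _); case: eqP => [->|nuz].
      by rewrite big1 // => i; rewrite eqxx.
    have [i ui] : exists i, u i != z i.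
      apply/existsP; rewrite -negb_forall; apply/negP => /forallP uz.
      by apply: nuz; apply/ffunP => i; apply/eqP.
    by rewrite (bigD1 i) //= (negPf ui) mul0r.
  rewrite (bigD1 (lift ord0 (z i))) //= big1 ?addr0 => [|a /negPf->].
    by rewrite inE eqxx mulrN1 (inj_eq lift_inj) eq_sym subr0.
  by rewrite inE oppr0 mulr0.
have [v vT] := set0Pn _ T0.
under eq_bigr => x _ do rewrite mulrCA -big_split /=.
rewrite -big_distrr -(bigA_distr_bigA (fun i a =>
    ((a == lift ord0 (u i))%:R - (a == ord0)%:R) *
    (if i \in T then 1 else - (a == lift ord0 (z i))%:R))).
rewrite (bigD1 v) //= vT; under eq_bigr do rewrite mulr1.
rewrite big_split /= -(big_morph _ (@opprD F) (@oppr0 F)).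
have sum1 (b : 'I_r.+1) : \sum_a (a == b)%:R = 1 :> F.
  by rewrite (bigD1 b) //= eqxx big1 ?addr0 // => a /negPf->.
by rewrite !sum1 subrr mul0r mulr0.
Qed.

(** Weight every [T] by [2 ^ #|T|], which is at least [2 ^ h] on the sets counted; the sum over all
    sets is [(2 + r) ^ n]. *)
Lemma source_rank_bound : (4 * #|node h| <= r + 2)%N ->
  (2 ^ h * source_rank <= 2 * r ^ #|node h|)%N.
Proof.
set n := #|node h| => le_nr.
(* For [m = n] the last term is at most half of [(r + 2) ^ n], because [4 * n <= r + 2]. *)
have bern m : ((r + 2) ^ m <= r ^ m + 2 * m * (r + 2) ^ m.-1)%N.
  elim: m => [//|m IHm]; rewrite succnK mulnS mulnDl expnS.
  have le1 : (2 * m * ((r + 2) * (r + 2) ^ m.-1) <= 2 * m * (r + 2) ^ m)%N.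
    by case: (m) => // m'; rewrite -expnS.
  by rewrite expnS; nia.
have le_r2 : ((r + 2) ^ n <= 2 * r ^ n)%N.
  have n0 : (0 < n)%N by rewrite /n; apply/card_gt0P; exists (apex h).
  have le4 : (4 * n * (r + 2) ^ n.-1 <= (r + 2) ^ n)%N.
    by rewrite -[in leqRHS](prednK n0) expnS leq_mul2r le_nr orbT.
  have := bern n; lia.
apply: leq_trans le_r2.
rewrite /source_rank big_distrr /= addnC.
have -> : ((2 + r) ^ n = \sum_(T : {set node h}) 2 ^ #|T| * r ^ (n - #|T|))%N.
  transitivity (\prod_(i : node h) (2 + r))%N; first by rewrite prod_nat_const.
  rewrite bigA_distr.
  by apply: eq_bigr => T _; rewrite prod_if_set.
rewrite big_mkcond leq_sum // => T _; case: ifP => // leh.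
by rewrite leq_mul2r leq_pexp2l ?orbT.
Qed.

End PebblingMatrix.

(** * Translated clauses at Boolean points *)

Section ClausePoly.

Variables (F : fieldType) (N : nat).
Implicit Types (C : clause N) (a : 'I_N -> bool).

Lemma clause_poly_meval C a :
  (clause_poly F C).@[fun i => (a i)%:R] = (~~ sat_clause a C)%:R.
Proof.
rewrite /clause_poly rmorphM !rmorph_prod /=.
case: (boolP (sat_clause a C)) => [/exists_inP[[i b] iC /= /eqP ab]|unsatC].
  case: b ab iC => ab iC.
    by rewrite (bigD1 i) //= rmorphB /= meval1 mevalXU ab subrr !mul0r.
  by rewrite [X in _ * X](bigD1 i) //= mevalXU ab mul0r mulr0.
have ab i b : (i, b) \in C -> a i = ~~ b.
  move=> iC; apply/eqP; apply: contraNT unsatC => nab.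
  by apply/exists_inP; exists (i, b) => //=; move: nab; case: (a i); case: b iC.
rewrite !big1 ?mulr1 // => i /ab ai; first by rewrite mevalXU ai.
by rewrite rmorphB /= meval1 mevalXU ai subr0.
Qed.

Lemma boolean_axiom_meval (i : 'I_N) a :
  ('X_i ^+ 2 - 'X_i : {mpoly F[N]}).@[fun i => (a i)%:R] = 0.
Proof.
by rewrite rmorphB rmorphXn /= mevalXU; case: (a i); rewrite ?expr1n ?expr0n subrr.
Qed.

End ClausePoly.

(** * The pebbling formula and its unsatisfiability *)

Section Formula.

Variables h r : nat.

Definition point : finType := (node h * 'I_r.+1)%type.

(* In this order: [x i = a /\ x j = b /\ x k = c], [x i <= a], [z i = a], and
   [z i <> a /\ z j <> b]. The first two kinds are the x-variables, the third the
   y-variables, the last the z-variables. *)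
Definition var : finType :=
  (point * point * point + point + (point + point * point))%type.

Definition xtriple (p q t : point) : var := inl (inl (p, q, t)).
Definition xle (p : point) : var := inl (inr p).
Definition yeq (p : point) : var := inr (inl p).
Definition zneq2 (p q : point) : var := inr (inr (p, q)).

Definition is_x (v : var) := if v is inl _ then true else false.
Definition is_y (v : var) := if v is inr (inl _) then true else false.
Definition is_z (v : var) := if v is inr (inr _) then true else false.

(** Only these assignments enter the rank argument. Packing three or two conditions into one
    variable lets a pebbling rule fit into three literals. *)
Definition valuation (x : xinput h r) (z : zinput h r) (v : var) : bool :=
  let zv i := lift ord0 (z i) in
  match v with
  | inl (inl (p, q, t)) => [&& x p.1 == p.2, x q.1 == q.2 & x t.1 == t.2]
  | inl (inr p) => (x p.1 <= p.2)%N
  | inr (inl p) => zv p.1 == p.2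
  | inr (inr (p, q)) => (zv p.1 != p.2) && (zv q.1 != q.2)
  end.

Let N := #|var|.

Definition assignment (x : xinput h r) (z : zinput h r) (i : 'I_N) : bool :=
  valuation x z (enum_val i).

Definition vars_of (P : pred var) : {set 'I_N} := [set i | P (enum_val i)].

Definition clause_of (s : seq (var * bool)) : clause N :=
  [set l in [seq (enum_rank l.1, l.2) | l <- s]].

Lemma card_clause_of s : (#|clause_of s| <= size s)%N.
Proof. by rewrite cardsE (leq_trans (card_size _)) ?size_map. Qed.

Lemma sat_clause_of a s :
  sat_clause a (clause_of s) = has (fun l => a (enum_rank l.1) == l.2) s.
Proof.
apply/exists_inP/hasP => [[l]|[l ls al]].
  by rewrite inE => /mapP[l' l's ->] /= al; exists l'.
by exists (enum_rank l.1, l.2); rewrite ?inE ?map_f.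
Qed.

Definition small_clause (P : pred var) (C : clause N) :=
  (#|C| <= 3)%N && ([set l.1 | l in C] \subset vars_of P).

Lemma small_clause_of P s :
  (size s <= 3)%N -> all (fun l => P l.1) s -> small_clause P (clause_of s).
Proof.
move=> les /allP Ps; rewrite /small_clause (leq_trans (card_clause_of _)) //=.
apply/subsetP => i /imsetP[l]; rewrite inE => /mapP[l' l's ->] ->.
by rewrite inE /= enum_rankK Ps.
Qed.

(* A pebbling rule other than the rule that sources are pebbled fails. *)
Definition violated (x : xinput h r) (z : zinput h r) :=
  ~~ agree x z (apex h) ||
  [exists v, [&& ~~ source v, ~~ agree x z (row_pred v), ~~ agree x z (col_pred v)
    & agree x z v]].

(** On inputs it fails on a rectangle that fixes the symbols of [x] and [z] at one source; these are
    the clauses that cost rank. *)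
Definition source_clause (p : point) : clause N :=
  clause_of [:: (xtriple p p p, false); (zneq2 p p, true)].

(** The first set is chosen by meaning, so that [pebmat] vanishes wherever one of its clauses fails
    and no list of clauses has to be analysed. *)
Definition peb0 : cnf N :=
  [set C | small_clause (fun v => is_x v || is_z v) C &&
     [forall x, forall z, sat_clause (assignment x z) C || violated x z]]
  :|: [set source_clause p | p : point & source p.1].

(** No input falsifies these clauses. Through the y-variables they derive [zneq2] for a pair of
    points from [zneq2] for each point alone. *)
Definition peb1 : cnf N :=
  [set C | small_clause (fun v => is_y v || is_z v) C &&
     [forall x, forall z, sat_clause (assignment x z) C]].

Lemma peb0_small C : C \in peb0 -> small_clause (fun v => is_x v || is_z v) C.
Proof.
rewrite !inE => /orP[/andP[]//|/imsetP[p _ ->]].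
exact: small_clause_of.
Qed.

Lemma peb1_small C : C \in peb1 -> small_clause (fun v => is_y v || is_z v) C.
Proof. by rewrite inE => /andP[]. Qed.

Lemma small_cnf_vars (P Q : pred var) (phi : cnf N) :
  (forall C, C \in phi -> small_clause (fun v => P v || Q v) C) ->
  cnf_vars phi \subset vars_of P :|: vars_of Q.
Proof.
move=> small; apply/bigcupsP => C /small/andP[_ /subset_trans]; apply.
by apply/subsetP => i; rewrite !inE.
Qed.

Lemma vars_of_disjoint (P Q : pred var) :
  (forall v, ~~ (P v && Q v)) -> [disjoint vars_of P & vars_of Q].
Proof.
move=> PQ; rewrite disjoint_subset; apply/subsetP => i; rewrite !inE => Pi.
by have := PQ (enum_val i); rewrite Pi.
Qed.

Lemma vars_of_cover : vars_of is_x :|: vars_of is_y :|: vars_of is_z = [set: 'I_N].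
Proof. by apply/setP => i; rewrite !inE; case: (enum_val i) => [|[]]. Qed.

Definition pebbling_cnf : split_cnf :=
  @SplitCNF N (vars_of is_x) (vars_of is_y) (vars_of is_z) peb0 peb1
    (@vars_of_disjoint is_x is_y ltac:(by case=> [|[]]))
    (@vars_of_disjoint is_x is_z ltac:(by case=> [|[]]))
    (@vars_of_disjoint is_y is_z ltac:(by case=> [|[]]))
    vars_of_cover (small_cnf_vars peb0_small) (small_cnf_vars peb1_small).

Lemma peb0_kcnf : is_kcnf 3 peb0.
Proof. by move=> C /peb0_small/andP[]. Qed.

Lemma peb1_kcnf : is_kcnf 3 peb1.
Proof. by move=> C /peb1_small/andP[]. Qed.

Section Unsat.

Variable a : 'I_N -> bool.
Hypothesis sat_a : sat_cnf a (peb0 :|: peb1).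

Let b v := a (enum_rank v).

Let has_literal s : clause_of s \in peb0 :|: peb1 -> has (fun l => b l.1 == l.2) s.
Proof. by move=> sphi; rewrite -sat_clause_of; apply: (forall_inP sat_a). Qed.

Let peb0_literal s :
  (size s <= 3)%N -> all (fun l => is_x l.1 || is_z l.1) s ->
  (forall x z, ~~ has (fun l => valuation x z l.1 == l.2) s -> violated x z) ->
  has (fun l => b l.1 == l.2) s.
Proof.
move=> les varss sem; apply: has_literal; apply/setUP; left; apply/setUP; left.
rewrite inE small_clause_of //=; apply/forallP => x; apply/forallP => z.
have [_|nv] := boolP (violated x z); first by rewrite orbT.
rewrite orbF sat_clause_of; apply: contraR nv => nhas; apply: sem; apply: contra nhas.
case/hasP=> l ls sl; apply/hasP; exists l => //.
by rewrite /assignment enum_rankK.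
Qed.

Let peb1_literal s :
  (size s <= 3)%N -> all (fun l => is_y l.1 || is_z l.1) s ->
  (forall x z, has (fun l => valuation x z l.1 == l.2) s) ->
  has (fun l => b l.1 == l.2) s.
Proof.
move=> les varss sem; apply: has_literal; apply/setUP; right; rewrite inE.
rewrite small_clause_of //=; apply/forallP => x; apply/forallP => z.
rewrite sat_clause_of; have /hasP[l ls sl] := sem x z.
by apply/hasP; exists l => //; rewrite /assignment enum_rankK.
Qed.

(** [c] is the least symbol with [xle] true. This ladder replaces the wide clause saying that some
    symbol is taken. *)
Let xvalue i : exists c, b (xtriple (i, c) (i, c) (i, c)).
Proof.
have bmax : b (xle (i, ord_max)).
  have := @peb0_literal [:: (xle (i, ord_max), true)] isT isT.
  by rewrite /= !orbF eqb_id; apply=> x z; rewrite /= leq_ord.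
case: (@arg_minnP _ ord_max (fun c => b (xle (i, c))) val bmax) => c bc minc.
(* At symbol 0 there is no lower rung, and the clause has two literals. *)
exists c; case: (posnP c) => [c0|c0].
  have := @peb0_literal [:: (xle (i, c), false); (xtriple (i, c) (i, c) (i, c), true)] isT isT.
  rewrite /= bc orbF eqb_id; apply=> x z /=.
  have -> : (x i <= c)%N = (x i == c) by rewrite -val_eqE /= c0 leqn0.
  by case: (x i == c).
have ltc : (c.-1 < r.+1)%N by rewrite (leq_ltn_trans (leq_pred c)).
have := @peb0_literal [:: (xle (i, c), false); (xtriple (i, c) (i, c) (i, c), true);
  (xle (i, Ordinal ltc), true)] isT isT.
rewrite /= bc orbF /= !eqb_id => /(_ _)/orP[|//|bc'].
  move=> x z; have -> : (x i <= c.-1)%N = (x i < c)%N by rewrite -ltnS prednK.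
  have -> : (x i <= c)%N = (x i == c) || (x i < c)%N by rewrite leq_eqVlt -val_eqE.
  by case: (x i == c); case: ltnP.
by have := minc _ bc'; rewrite /= leqNgt prednK // leqnn.
Qed.

(** With the symbols [c] fixed, falsity of [yeq (p i)] means that [i] is pebbled. This spreads from
    the sources to the apex, where it is forbidden. *)
Lemma peb_unsat : False.
Proof.
have [c bc] := fin_all_exists xvalue.
pose p i : point := (i, c i).
(* The triple is built in two stages, since the direct clause would have four literals. *)
have btriple i j k : b (xtriple (p i) (p j) (p k)).
  have := @peb0_literal [:: (xtriple (p i) (p j) (p j), false);
    (xtriple (p k) (p k) (p k), false); (xtriple (p i) (p j) (p k), true)] isT isT.
  rewrite /= bc orbF /= eqb_id => /(_ _)/orP[|bF|//].
    by move=> x z /=; case: (x i == c i); case: (x j == c j); case: (x k == c k).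
  have := @peb0_literal [:: (xtriple (p i) (p i) (p i), false);
    (xtriple (p j) (p j) (p j), false); (xtriple (p i) (p j) (p j), true)] isT isT.
  rewrite /= !bc orbF /= (eqP bF) => lit; suff: false by []; apply: lit.
  by move=> x z /=; case: (x i == c i); case: (x j == c j).
have yz i j : [|| b (yeq (p i)), b (yeq (p j)) | b (zneq2 (p i) (p j))].
  have := @peb1_literal [:: (yeq (p i), true); (yeq (p j), true); (zneq2 (p i) (p j), true)]
    isT isT.
  by rewrite /= orbF !eqb_id; apply=> x z /=; case: (_ == c i); case: (_ == c j).
have zy i : b (zneq2 (p i) (p i)) -> ~~ b (yeq (p i)).
  have := @peb1_literal [:: (zneq2 (p i) (p i), false); (yeq (p i), false)] isT isT.
  rewrite /= orbF !eqbF_neg => /(_ _)/orP[|/negPf->//|//].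
  by move=> x z /=; case: (_ == c i).
have : ~~ b (yeq (p (apex h))).
  elim/apex_ind: (apex h) => v srcv.
    apply: zy; have : source_clause (p v) \in peb0 :|: peb1.
      by rewrite !inE imset_f ?orbT // inE.
    by move/has_literal; rewrite /= bc orbF eqb_id.
  move=> /negPf y1 /negPf y2; apply: zy.
  have := @peb0_literal [:: (xtriple (p (row_pred v)) (p (col_pred v)) (p v), false);
    (zneq2 (p (row_pred v)) (p (col_pred v)), false); (zneq2 (p v) (p v), true)] isT isT.
  have := yz (row_pred v) (col_pred v); rewrite y1 y2 /= => ->; rewrite btriple orbF eqb_id.
  apply=> x z /=; rewrite !eqbF_neg !orbF !eqb_id andbb !negb_or !negbK.
  case/and3P=> /and3P[/eqP x1 /eqP x2 /eqP xv] /andP[z1 z2] zv.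
  apply/orP; right; apply/existsP; exists v.
  by rewrite srcv /agree x1 x2 xv ![_ == lift _ _]eq_sym z1 z2 zv.
have := yz (apex h) (apex h); case: (b (yeq _)) => //= bz _.
have := @peb0_literal [:: (xtriple (p (apex h)) (p (apex h)) (p (apex h)), false);
  (zneq2 (p (apex h)) (p (apex h)), false)] isT isT.
rewrite /= bc bz => lit; suff: false by []; apply: lit => x z /=.
rewrite !eqbF_neg orbF negb_or !negbK !andbb.
by case/andP=> /eqP xa za; apply/orP; left; rewrite /agree xa eq_sym.
Qed.

End Unsat.

Lemma pebbling_cnf_unsat : unsatisfiable (formula pebbling_cnf).
Proof. by move=> a; apply/negP => /peb_unsat. Qed.

End Formula.

(** * From a refutation to a rank bound *)

Lemma x_first_cut (phi : split_cnf) (s : 'S_(nvars phi)) : x_first s ->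
  exists2 k, (k <= nvars phi)%N & forall i : 'I_(nvars phi), (i < k)%N = (s i \in xvars phi).
Proof.
(* The cut is the first position of a variable outside [xvars], or the end. *)
move=> xfirst; case: (pickP (fun i => s i \notin xvars phi)) => [i0 ni0|allx].
  case: (@arg_minnP _ i0 (fun i => s i \notin xvars phi) val ni0) => k nk mink.
  exists k; first exact: ltnW.
  move=> i; apply/idP/idP => [|si]; last exact: xfirst.
  by apply: contraTT => /mink; rewrite -leqNgt.
exists (nvars phi) => // i; rewrite ltn_ord.
by have := allx i; case: (_ \in _).
Qed.

Section RefutationRank.

Variables (F : fieldType) (h r : nat).
Hypothesis r_gt0 : (0 < r)%N.

Let phi := pebbling_cnf h r.

Variables (s : 'S_(nvars phi)) (G : {mpoly F[nvars phi]} -> roABP F s).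
Hypothesis xfirst : x_first s.

Let val01 x z : 'I_(nvars phi) -> F := fun i => (assignment x z i)%:R.

Lemma rank_le_roABP (A : roABP F s) :
  rank_le (roABP_width A) (fun x z => (roABP_poly A).@[val01 x z]).
Proof.
have [k lek kP] := x_first_cut xfirst.
have [a [b [ab aloc bloc]]] := roABP_poly_cut A lek.
(* Arbitrary inputs: [a] reads only the x-variables and [b] only the others. *)
pose x0 : xinput h r := [ffun=> ord0]; pose z0 : zinput h r := [ffun=> Ordinal r_gt0].
exists (fun x => a (val01 x z0)), (fun i z => b (val01 x0 z) i) => x z.
rewrite ab; apply: eq_bigr => i _; congr (_ * _).
  apply: aloc => j; rewrite kP inE /val01 /assignment.
  by case: (enum_val _) => [[[[p q] t]|p]|].
apply: bloc => j; rewrite leqNgt kP inE /val01 /assignment.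
by case: (enum_val _) => [|[p|[p q]]].
Qed.

(** Evaluate the refutation identity and multiply it by [pebmat]: only the polynomials of source
    clauses contribute rank. *)
Lemma refutation_rank : is_refutation (formula phi) G ->
  rank_le (#|point h r| * (refutation_width (formula phi) G * source_rank h r))
    (@pebmat F h r).
Proof.
set w := refutation_width _ _; set L := standard_translation F (formula phi) => ref.
pose srcs := [seq clause_poly F (source_clause p) | p in [pred p : point h r | source p.1]].
pose d q := (if q \in srcs then w * source_rank h r else 0)%N.
have rank_term q : q \in L ->
    rank_le (d q) (fun x z => (roABP_poly (G q)).@[val01 x z] * q.@[val01 x z] * pebmat F x z).
  move=> qL; rewrite /d; case: ifP => [/imageP[p]|nsrc].
    rewrite inE => srcp qE.
    have [B rkB BE] := pebmat_source F r_gt0 srcp.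
    have lew : (roABP_width (G q) <= w)%N by apply: leq_bigmax_seq.
    have := rank_leM (rank_le_leq lew (rank_le_roABP (G q)))
      (rank_leM (rank_le_rank1 (fun x : xinput h r => (x p.1 == p.2)%:R)
                               (fun z : zinput h r => (lift ord0 (z p.1) == p.2)%:R)) rkB).
    rewrite mul1n; apply: rank_le_ext => x z; rewrite -mulrA; congr (_ * _).
    rewrite qE clause_poly_meval sat_clause_of /= /assignment !enum_rankK /= !andbb orbF.
    rewrite eqbF_neg eqb_id negb_or !negbK.
    case: (boolP (x p.1 == p.2)) => /= [/eqP xp|_]; last by rewrite !mul0r.
    case: (boolP (lift _ _ == _)) => [/eqP zp|_]; last by rewrite mulr0 !mul0r.
    by rewrite !mul1r BE // /agree xp zp.
  (* Every other term vanishes on all inputs. *)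
  apply: rank_le_ext (rank_le0 F _ _ 0) => x z.
  move: qL; rewrite mem_undup mem_cat => /orP[] /imageP[].
    move=> C; rewrite !inE => Cphi qE; rewrite qE clause_poly_meval.
    case: (boolP (sat_clause _ C)) => [_|nsat]; first by rewrite mulr0 mul0r.
    suff -> : pebmat F x z = 0 by rewrite mulr0.
    have vio : violated x z.
      case/orP: Cphi => [/orP[]|]; last 1 first.
      - by case/andP=> _ /forallP/(_ x)/forallP/(_ z); rewrite (negPf nsat).
      - by case/andP=> _ /forallP/(_ x)/forallP/(_ z); rewrite (negPf nsat).
      case/imsetP=> p; rewrite inE => srcp CE; case/negP: nsrc.
      by rewrite qE CE; apply: image_f; rewrite inE.
    case/orP: vio => [|/existsP[v /and4P[]]]; first exact: pebmat_apex.
    exact: pebmat_pred.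
  by move=> i _ ->; rewrite boolean_axiom_meval mulr0 mul0r.
have pebE x z : pebmat F x z = \sum_(q <- L | q \in L)
    (roABP_poly (G q)).@[val01 x z] * q.@[val01 x z] * pebmat F x z.
  rewrite -big_seq -big_distrl /= -[LHS]mul1r; congr (_ * _).
  rewrite -(meval1 (val01 x z)) -ref rmorph_sum.
  by apply: eq_bigr => q _; rewrite rmorphM.
apply: rank_le_ext pebE _; apply: rank_le_leq (rank_le_sum _ rank_term).
(* [L] has no duplicates, so at most one term per point is charged. *)
rewrite -big_seq /d -big_mkcond /= big_const_seq iter_addn_0 mulnC leq_mul2r.
apply/orP; right; rewrite -size_filter.
have /leq_trans : (size [seq q <- L | q \in srcs] <= size srcs)%N.
  apply: uniq_leq_size; first by rewrite filter_uniq ?undup_uniq.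
  by move=> q; rewrite mem_filter => /andP[].
by apply; rewrite size_image max_card.
Qed.

Lemma refutation_width_bound : (4 * #|node h| <= r + 2)%N ->
  is_refutation (formula phi) G ->
  (2 ^ h <= 2 * #|point h r| * refutation_width (formula phi) G)%N.
Proof.
move=> le_nr /refutation_rank/pebmat_rank le1.
have le2 := source_rank_bound le_nr.
have rn0 : (0 < r ^ #|node h|)%N by rewrite expn_gt0 r_gt0.
rewrite -(leq_pmul2r rn0).
move: le1 le2 rn0; set D := source_rank h r; set w := refutation_width _ _.
set P := #|point h r|; set R := (r ^ _)%N; set H := (2 ^ h)%N => le1 le2 _.
have le3 : (H * R <= H * (P * (w * D)))%N by rewrite leq_mul2l le1 orbT.
have le4 : (P * w * (H * D) <= P * w * (2 * R))%N by rewrite leq_mul2l le2 orbT.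
by apply: leq_trans le3 _; lia.
Qed.

End RefutationRank.

(** * Parameters and the final estimate *)

Definition pebbling_family (n : nat) : split_cnf :=
  let h := ((n + 40) * 2)%N in pebbling_cnf h (4 * h.+1 ^ 2).

Lemma exp2_quartic_bound g : (40 <= g)%N -> ((6 * g) ^ 4 <= 2 ^ g)%N.
Proof.
have step y : (40 <= y -> (6 * y) ^ 4 <= 2 ^ y -> (6 * y.+1) ^ 4 <= 2 ^ y.+1)%N.
  move=> le40 IHy; rewrite (expnS 2) (leq_trans _ (leq_mul (leqnn 2) IHy)) //.
  rewrite !expnMn mulnCA leq_mul //.
  by rewrite !expnS !expn0 !muln1; nia.
elim: g => [//|g IHg]; rewrite leq_eqVlt => /predU1P[<-|ltg].
  (* At 40 the claim is [240 ^ 4 <= (2 ^ 10) ^ 4]. *)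
  by rewrite (expnM 2 10 4) leq_exp2r.
exact: step (IHg ltg).
Qed.

Lemma card_node h : #|node h| = (h.+1 ^ 2)%N.
Proof. by rewrite card_prod card_ord. Qed.

Lemma card_point h r : #|point h r| = (h.+1 ^ 2 * r.+1)%N.
Proof. by rewrite card_prod card_node card_ord. Qed.

Lemma card_var h r :
  #|var h r| = (#|point h r| ^ 3 + #|point h r| + (#|point h r| + #|point h r| ^ 2))%N.
Proof. by rewrite !card_sum !(card_prod _ (point h r)) !expnS !muln1 mulnA. Qed.

(** The constant is 9 * 45, from [h.+1 <= 3 * g] and at most [45 * g ^ 2] symbols. *)
Lemma card_point_bound g (h := (g * 2)%N) : (40 <= g)%N ->
  (#|point h (4 * h.+1 ^ 2)| <= 405 * g ^ 4)%N.
Proof.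
move=> le40; rewrite card_point.
have leH : (h.+1 <= 3 * g)%N by rewrite /h; lia.
have leH2 : (h.+1 ^ 2 <= 9 * g ^ 2)%N.
  by rewrite -[9%N]/(3 ^ 2)%N -expnMn leq_exp2r.
have g2 : (1 <= g ^ 2)%N by rewrite expn_gt0; lia.
have -> : (g ^ 4 = g ^ 2 * g ^ 2)%N by rewrite -expnD.
have H2 : (1 <= h.+1 ^ 2)%N by rewrite expn_gt0.
have le5 : ((4 * h.+1 ^ 2).+1 <= 45 * g ^ 2)%N by lia.
by have := leq_mul leH2 le5; lia.
Qed.

(** With [g = n + 40] there are at most [g ^ 6] points, so each of the four summands is at most
    [g ^ 18]; a further [g ^ 6] absorbs the 4. *)
Lemma nvars_bound n : (nvars (pebbling_family n) <= (n + 40) ^ 24)%N.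
Proof.
have le40 : (40 <= n + 40)%N by apply: leq_addl.
rewrite /= card_var; move: le40 (card_point_bound le40); set M := #|_|.
move: (n + 40)%N => g le40 leM.
have le405 : (405 <= g ^ 2)%N by rewrite expnS expn1; nia.
have {}leM : (M <= g ^ 6)%N.
  by apply: leq_trans leM _; rewrite (expnD g 2 4) leq_mul2r le405 orbT.
have g_gt0 : (0 < g)%N by lia.
have le3 k : (0 < k <= 3)%N -> (M ^ k <= g ^ 18)%N.
  case/andP=> k0 lek3; apply: (@leq_trans ((g ^ 6) ^ k)%N); first by rewrite leq_exp2r.
  by rewrite -expnM leq_pexp2l // (leq_mul2l 6 k 3) lek3.
have le4 : (4 * g ^ 18 <= g ^ 24)%N.
  rewrite (expnD g 6 18) leq_mul2r; apply/orP; right.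
  rewrite (expnD g 2 4) (leq_trans (_ : 4 <= 405 * 1)%N) // leq_mul // expn_gt0 g_gt0.
  by [].
have := le3 3%N isT; have := le3 2%N isT; have := le3 1%N isT; rewrite expn1.
by lia.
Qed.

Lemma nvars_gt n : (n < nvars (pebbling_family n))%N.
Proof.
rewrite /= card_var addnAC -addnA addnCA.
apply: leq_trans (leq_addr _ _); rewrite card_point expnS expn1.
by apply: leq_trans (_ : n < ((n + 40) * 2).+1)%N _; [lia | nia].
Qed.

Lemma INR_expn (a k : nat) : INR (a ^ k)%N = pow (INR a) k.
Proof. by elim: k => [//|k IHk]; rewrite expnS mult_INR IHk. Qed.

Lemma Rpower2_root_bound (N g w : nat) : (0 < g)%N -> (0 < N)%N -> (N <= g ^ 24)%N ->
  (2 ^ g <= w)%N -> (Rpower 2 (Rpower (INR N) (/ 24)) <= INR w)%coqR.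
Proof.
move=> g0 N0 leN lew.
have INRg : (0 < INR g)%coqR by apply: lt_0_INR; apply/ltP.
have le_root : (Rpower (INR N) (/ 24) <= INR g)%coqR.
  apply: (Rle_trans _ (Rpower (pow (INR g) 24) (/ 24))).
    apply: Rle_Rpower_l; first lra.
    split; first by apply: lt_0_INR; apply/ltP.
    by rewrite -INR_expn; apply: le_INR; apply/leP.
  rewrite -Rpower_pow // Rpower_mult (_ : (INR 24 * / 24 = 1)%coqR).
    by rewrite Rpower_1 //; apply: Rle_refl.
  by rewrite INR_IZR_INZ /=; field.
apply: (Rle_trans _ (Rpower 2 (INR g))).
  by apply: Rle_Rpower => //; lra.
rewrite Rpower_pow; last lra.
have -> : 2%coqR = INR 2 by [].
by rewrite -INR_expn; apply: le_INR; apply/leP.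
Qed.

Local Close Scope ring_scope.

Theorem theorem3p10 (F : fieldType) :
  exists phi : nat -> split_cnf,
    (forall m : nat, exists n : nat, m <= nvars (phi n)) /\
    (forall n : nat,
       [/\ is_kcnf 3 (phi0 (phi n)), is_kcnf 3 (phi1 (phi n))
         & unsatisfiable (formula (phi n))]) /\
    exists (eps : R) (N0 : nat),
      (0 < eps)%coqR /\
      forall n : nat, N0 <= nvars (phi n) ->
      forall s : 'S_(nvars (phi n)), x_first s ->
      forall G : {mpoly F[nvars (phi n)]} -> roABP F s,
        is_refutation (formula (phi n)) G ->
        (Rpower 2 (Rpower (INR (nvars (phi n))) eps)
           <= INR (refutation_width (formula (phi n)) G))%coqR.
Proof.
exists pebbling_family; split; last split.
- by move=> m; exists m; apply: ltnW (nvars_gt m).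
- by move=> n; split; [apply: peb0_kcnf | apply: peb1_kcnf | apply: pebbling_cnf_unsat].
(* The exponent inverts the power in [nvars_bound]; the bound holds for the whole family. *)
exists (/ 24)%coqR, 0; split=> [|n _ s xfirst G ref]; first lra.
have le40 : 40 <= n + 40 by apply: leq_addl.
apply: (@Rpower2_root_bound _ (n + 40)); rewrite ?nvars_bound //.
- by rewrite (leq_trans _ le40).
- exact: leq_ltn_trans (nvars_gt n).
have := @refutation_width_bound F _ _ _ s G xfirst _ ref.
set w := refutation_width _ _; rewrite muln_gt0 expn_gt0 card_node => /(_ isT).
rewrite leq_addr expnM => /(_ isT).
have := card_point_bound le40; have := exp2_quartic_bound le40.
rewrite expnMn; set M := #|_|; set e := 2 ^ (n + 40).
move=> le_quartic leM le_width.
(* Since [h] is twice [n + 40], [2 ^ h] is [e * e]. One factor pays for [2 * M], as 2 * 405 is below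
   [6 ^ 4]; the other is the bound. *)
have le2M : 2 * M <= e by lia.
have e0 : 0 < e by rewrite expn_gt0.
by rewrite -(leq_pmul2l e0) (leq_trans _ (leq_mul le2M (leqnn w))) // -expnS.
Qed.
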